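(* Let $\mu$ be a positive, finite, compactly supported Borel measure on $\mathbb{C}$ with infinite support. For each $n\in\mathbb{N}$, let $Q_n$ be a polynomial of degree exactly $n$ with leading coefficient $\tau_n$, such that (1) $\lim_{n\to\infty}\|Q_n\|_{L^2(\mu)}=1$, and (2) $\lim_{n\to\infty}\tau_n/\kappa_n=1$. Then $$\lim_{n\to\infty}\frac{Q_n(z)}{p_n(z;\mu)}=1$$ for all $z\notin\mathrm{ch}(\mu)$. Furthermore, the convergence is uniform on compact subsets of $\overline{\mathbb{C}}\setminus\mathrm{ch}(\mu)$.
   Context: $\overline{\mathbb{C}}$ is the Riemann sphere. $p_n(z;\mu)=\kappa_n z^n+\cdots$, with $\kappa_n>0$, is the degree-$n$ orthonormal polynomial of $\mu$: $\int \overline{p_n(z;\mu)}\,p_m(z;\mu)\,d\mu(z)=\delta_{nm}$ (obtained by Gram–Schmidt from $1,z,z^2,\dots$ in $L^2(\mu)$). $\mathrm{ch}(\mu)$ is the convex hull of $\mathrm{supp}(\mu)$; all zeros of $p_n(\cdot;\mu)$ lie in $\mathrm{ch}(\mu)$. The quotient $Q_n/p_n$ is regarded as an analytic function near $\infty$, with value $\tau_n/\kappa_n$ at $\infty$. *)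

(* Defs.v *)
From HB Require Import structures.
From mathcomp Require Import all_boot all_order all_algebra.
From mathcomp Require Import all_classical all_reals all_analysis.
From mathcomp Require Import complex.

Set Implicit Arguments.
Unset Strict Implicit.
Unset Printing Implicit Defensive.

Import Order.TTheory GRing.Theory Num.Theory.
Import numFieldNormedType.Exports.

Local Open Scope classical_set_scope.
Local Open Scope ring_scope.
Local Open Scope complex_scope.

(* The complex plane is R[i], with its norm topology and its Borel
   sigma-algebra. *)
HB.instance Definition _ (R : realType) := NormedModule.copy R[i] R[i]^o.
HB.instance Definition _ (R : realType) :=
  Measurable.copy R[i] (g_sigma_algebraType (@open R[i])).

Section Definitions.
Context {R : realType}.
Implicit Types (mu : {measure set R[i] -> \bar R}) (P Q : {poly R[i]}).

Definition supp mu : set R[i] :=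
  [set z | forall U : set R[i], open U -> U z -> (0 < mu U)%E].

(* [Rcomplex R] is R[i] seen as a real vector space, so that the convex
   combinations below have real coefficients. *)
Definition convex_hull (A : set R[i]) : set R[i] :=
  \bigcap_(B in [set B : set R[i] |
                  @convex_set R (Rcomplex R) B /\ A `<=` B]) B.

Definition ch mu : set R[i] := convex_hull (supp mu).

Definition Cintegral mu (f : R[i] -> R[i]) : R[i] :=
  (\int[mu]_z complex.Re (f z)) +i* (\int[mu]_z complex.Im (f z)).

Definition inner mu (f g : R[i] -> R[i]) : R[i] :=
  Cintegral mu (fun z => (f z)^* * g z).

Definition L2norm mu (f : R[i] -> R[i]) : \bar R :=
  Lnorm mu 2%:E (fun z => (Normc.normc (f z))%:E).

(* On R[i], [0 < kappa] means that kappa is real and positive. *)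
Definition orthonormal_polys mu (p : nat -> {poly R[i]}) : Prop :=
  [/\ forall n, size (p n) = n.+1,
      forall n, 0 < lead_coef (p n)
    & forall n m, inner mu (horner (p n)) (horner (p m)) = (n == m)%:R].

(* The quotient of two polynomials of the same degree, extended to the point
   at infinity [None] by its limit there. *)
Definition sphere_quotient Q P (w : one_point_compactification R[i]) : R[i] :=
  if w is Some z then Q.[z] / P.[z] else lead_coef Q / lead_coef P.

End Definitions.

(* Main.v *)
(* Write Q_n = a_n p_n + r_n with a_n = tau_n / kappa_n and deg r_n < n, so that
   Q_n / p_n - a_n = r_n / p_n and, by orthogonality,
   ||r_n||^2 = ||Q_n||^2 - |a_n|^2 -> 0. Let z lie off the hull, separated from
   the support by a line at distance d, and let D be the largest distance from
   z to the support. The polynomial q = (p_n(z) r_n - r_n(z) p_n) / (x - z) has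
   degree < n, whence <q, (x - z) q> = p_n(z) <q, r_n> and
   <p_n, (x - z) q> = - r_n(z). The first identity gives
   d ||q|| <= |p_n(z)| ||r_n||, the second |r_n(z)| <= D ||q||, and therefore
   |r_n(z) / p_n(z)| <= (D / d) ||r_n||. The ratio D / d is locally bounded off
   the hull, infinity included, so the convergence is uniform on compact sets. *)
Require Import Defs.
From mathcomp Require Import all_boot all_order all_algebra.
From mathcomp Require Import all_classical all_reals all_analysis.
From mathcomp Require Import measurable_realfun complex.
From mathcomp Require Import ring lra.

Import Order.TTheory GRing.Theory Num.Theory.
Import numFieldNormedType.Exports.

Local Open Scope classical_set_scope.
Local Open Scope complex_scope.
Local Open Scope ring_scope.

(** * Positive semidefinite sesquilinear forms on polynomials *)

Definition psd_form {C : numClosedFieldType} (B : {poly C} -> {poly C} -> C) :=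
  [/\ forall a f g h, B f (a *: g + h) = a * B f g + B f h,
      forall f g, B g f = (B f g)^*
    & forall f, 0 <= B f f].

Lemma size_sub_lead_coef {F : fieldType} (n : nat) (p g : {poly F}) :
  size p = n.+1 -> (size g <= n.+1)%N ->
  (size (g - (g`_n / lead_coef p) *: p)%R <= n)%N.
Proof.
move=> sp sg; apply/leq_sizeP => j; rewrite coefB coefZ leq_eqVlt => /predU1P[<-|nj].
  have -> : lead_coef p = p`_n by rewrite lead_coefE sp.
  by rewrite divfK ?subrr // -[n]/(n.+1.-1) -sp -lead_coefE lead_coef_eq0 -size_poly_eq0 sp.
by rewrite (nth_default _ (leq_trans sg nj)) [p`_j]nth_default ?mulr0 ?subr0 ?sp.
Qed.

Section PsdForm.
Context {C : numClosedFieldType} (B : {poly C} -> {poly C} -> C).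
Hypothesis psdB : psd_form B.
Implicit Types (f g h p q r : {poly C}) (a b d z : C).

Lemma psdZDr a f g h : B f (a *: g + h) = a * B f g + B f h.
Proof. by case: psdB. Qed.

Lemma psd_conj f g : B g f = (B f g)^*.
Proof. by case: psdB. Qed.

Lemma psd_ge0 f : 0 <= B f f.
Proof. by case: psdB. Qed.

Lemma psd0r f : B f 0 = 0.
Proof.
have := psdZDr 1 f 0 0; rewrite scale1r addr0 mul1r => /eqP.
by rewrite addrC -subr_eq subrr eq_sym => /eqP.
Qed.

Lemma psdZr a f g : B f (a *: g) = a * B f g.
Proof. by rewrite -[a *: g]addr0 psdZDr psd0r addr0. Qed.

Lemma psdDr f g h : B f (g + h) = B f g + B f h.
Proof. by rewrite -[g]scale1r psdZDr mul1r scale1r. Qed.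

Lemma psdBr f g h : B f (g - h) = B f g - B f h.
Proof. by rewrite psdDr -scaleN1r psdZr mulN1r. Qed.

Lemma psdZl a f g : B (a *: f) g = a^* * B f g.
Proof. by rewrite psd_conj psdZr rmorphM /= -psd_conj. Qed.

Lemma psdBl f g h : B (f - g) h = B f h - B g h.
Proof. by rewrite psd_conj psdBr rmorphB /= -!psd_conj. Qed.

Lemma psdBZ a f g : B (f - a *: g) (f - a *: g) =
  B f f - a * B f g - a^* * (B f g)^* + `|a| ^+ 2 * B g g.
Proof.
rewrite psdBl !psdBr !psdZl !psdZr (psd_conj f g) normCK; ring.
Qed.

Lemma psd_cauchy_schwarz f g : `|B f g| ^+ 2 <= B f f * B g g.
Proof.
set b := B f g.
have key t : t^* = t -> 0 <= B f f - 2 * t * `|b| ^+ 2 + t ^+ 2 * `|b| ^+ 2 * B g g.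
  move=> tR; have := psd_ge0 (f - (t * b^*) *: g).
  rewrite psdBZ -/b !normCK !rmorphM /= !conjCK tR.
  by congr (_ <= _); ring.
have := psd_ge0 g; rewrite le_eqVlt => /orP[/eqP g0|g_gt0].
  have [->|b0] := eqVneq b 0; first by rewrite normr0 expr0n /= mulr_ge0 ?psd_ge0.
  have b2 : 0 < `|b| ^+ 2 by rewrite exprn_gt0 // normr_gt0.
  have fR : (B f f)^* = B f f by rewrite -psd_conj.
  have bR : (`|b| ^+ 2)^* = `|b| ^+ 2 by rewrite normCK rmorphM /= conjCK mulrC.
  (* Since [B g g] vanishes, [key] is affine in [t]; this [t] makes its right-hand side equal to
     [- (B f f + 2)], a contradiction. *)
  have tR : ((B f f + 1) / `|b| ^+ 2)^* = (B f f + 1) / `|b| ^+ 2.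
    by rewrite rmorphM /= fmorphV /= bR rmorphD /= fR rmorph1.
  have := key _ tR; rewrite -g0 mulr0 addr0.
  have -> : 2 * ((B f f + 1) / `|b| ^+ 2) * `|b| ^+ 2 = 2 * (B f f + 1).
    by rewrite -mulrA divfK // gt_eqF.
  have -> : B f f - 2 * (B f f + 1) = - (B f f + 2) by ring.
  rewrite oppr_ge0 => /le_gtF; rewrite ltr_wpDl ?psd_ge0 //.
have gR : (B g g)^* = B g g by rewrite -psd_conj.
(* The minimiser of the quadratic. *)
have := key ((B g g)^-1); rewrite fmorphV /= gR => /(_ erefl).
rewrite -(pmulr_lge0 _ g_gt0) -(subr_ge0 (`|b| ^+ 2)).
by congr (_ <= _); field; rewrite gt_eqF.
Qed.

(** The [P i] with [i < k] span the polynomials of size at most [k]; the induction strips off the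
    top one at each step. *)
Lemma psd_orthogonal (P : nat -> {poly C}) f k g :
  (forall n, size (P n) = n.+1) -> (forall i, (i < k)%N -> B f (P i) = 0) ->
  (size g <= k)%N -> B f g = 0.
Proof.
move=> sP; elim: k g => [|k IHk] g fP sg.
  by move: sg; rewrite leqn0 size_poly_eq0 => /eqP ->; exact: psd0r.
rewrite -(subrK ((g`_k / lead_coef (P k)) *: P k) g) addrC psdZDr fP // mulr0 add0r.
by apply: IHk (size_sub_lead_coef _ _ _ (sP k) sg) => i ik; apply: fP; exact: ltnW.
Qed.

(** Pythagoras: orthogonality of the remainder to [p] forces [B p q = a]. *)
Lemma psd_remainder p q a : B p p = 1 -> B p (q - a *: p) = 0 ->
  B (q - a *: p) (q - a *: p) = B q q - `|a| ^+ 2.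
Proof.
move=> p1; rewrite psdBr psdZr p1 mulr1 => /eqP; rewrite subr_eq0 => /eqP pq.
by rewrite psdBZ (psd_conj p q) pq p1 normCK conjCK; ring.
Qed.

Section Extremal.
Variables (n : nat) (p : {poly C}) (z d D : C).
Hypotheses (p1 : B p p = 1) (p_orth : forall g, (size g <= n)%N -> B p g = 0).
Hypotheses (sz_p : size p = n.+1) (d_gt0 : 0 < d) (D_ge0 : 0 <= D).
(** In the application [d] bounds from below the distance from [z] to the support along a separating
    direction, and [D] bounds the distances from [z] to the support from above. Both hypotheses thus
    concern multiplication by ['X - z%:P]. *)
Hypothesis lower : forall q, d * B q q <= `|B q (('X - z%:P) * q)|.
Hypothesis upper : forall q,
  B (('X - z%:P) * q) (('X - z%:P) * q) <= D ^+ 2 * B q q.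

(* With q = (p(z) r - r(z) p) / (X - z), orthogonality gives
   <q, (X - z) q> = p(z) <q, r> and <p, (X - z) q> = - r(z). *)
Lemma norm_horner_le_orthonormal r : (size r <= n)%N ->
  d ^+ 2 * `|r.[z]| ^+ 2 <= D ^+ 2 * `|p.[z]| ^+ 2 * B r r.
Proof.
move=> sz_r.
have /factor_theorem[q Eq] : root (p.[z] *: r - r.[z] *: p) z.
  by rewrite rootE !hornerE mulrC subrr.
rewrite mulrC in Eq.
have sz_q : (size q <= n)%N.
  have [->|q0] := eqVneq q 0; first by rewrite size_poly0.
  have : (size (('X - z%:P) * q)%R <= n.+1)%N.
    rewrite -Eq (leq_trans (size_polyD _ _)) // size_polyN geq_max.
    rewrite (leq_trans (size_scale_leq _ _)) ?(leq_trans sz_r) //=.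
    by rewrite (leq_trans (size_scale_leq _ _)) ?sz_p.
  by rewrite mulrC size_Mmonic ?monicXsubC // size_XsubC addn2.
have Bqp : B q p = 0 by rewrite psd_conj p_orth // rmorph0.
have le1 : d * B q q <= `|p.[z]| * `|B q r|.
  by rewrite (le_trans (lower q)) // -Eq psdBr !psdZr Bqp mulr0 subr0 normrM.
have q_ge0 := psd_ge0 q; have r_ge0 := psd_ge0 r.
have h1 : (d * B q q) ^+ 2 <= (`|p.[z]| * `|B q r|) ^+ 2.
  by rewrite lerXn2r // nnegrE mulr_ge0 // ltW.
have h2 : d ^+ 2 * B q q <= `|p.[z]| ^+ 2 * B r r.
  have [->|q0] := eqVneq (B q q) 0; first by rewrite mulr0 mulr_ge0 ?exprn_ge0.
  have q_gt0 : 0 < B q q by rewrite lt_def q0.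
  rewrite -(ler_pM2r q_gt0) -mulrA -expr2 -exprMn (le_trans h1) // exprMn -[leRHS]mulrA.
  by rewrite ler_wpM2l ?exprn_ge0 // mulrC psd_cauchy_schwarz.
have h3 : `|r.[z]| ^+ 2 <= D ^+ 2 * B q q.
  apply: le_trans (upper q).
  have := psd_cauchy_schwarz p (('X - z%:P) * q); rewrite p1 mul1r.
  by rewrite -Eq psdBr !psdZr p1 p_orth // mulr0 sub0r mulr1 normrN.
apply: (@le_trans _ _ (d ^+ 2 * (D ^+ 2 * B q q))).
  by rewrite ler_wpM2l // exprn_ge0 // ltW.
rewrite mulrCA -[leRHS]mulrA ler_wpM2l ?exprn_ge0 //.
Qed.

(** If [p] vanished at [z], the preceding estimate for the constant polynomial 1 would read
    [d ^+ 2 <= 0]. That polynomial is admissible only for positive [n]; in degree 0, [p] is a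
    nonzero constant. *)
Lemma orthonormal_neq0 : p.[z] != 0.
Proof.
apply/eqP => pz0; case: n sz_p p_orth norm_horner_le_orthonormal => [|m] sp _ le_p.
  have /size_poly1P[c c0 Ep] : (size p == 1)%N by rewrite sp.
  move: pz0; rewrite Ep.
  by rewrite hornerC => /eqP; rewrite (negPf c0).
have := le_p 1; rewrite size_poly1 => /(_ isT).
rewrite pz0 normr0 expr0n /= mulr0 mul0r hornerC normr1 expr1n mulr1.
by move/le_gtF; rewrite exprn_gt0.
Qed.

End Extremal.
End PsdForm.

(** * Topology of the complex plane and of the sphere *)

Section ComplexTopology.
Context {R : realType}.
Implicit Types (x y z : R[i]) (A : set R[i]).

Lemma normr_Re x : `|complex.Re x|%:C <= `|x|.
Proof.
by case: x => a b; rewrite normc_def lecR -sqrtr_sqr ler_wsqrtr // lerDl sqr_ge0.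
Qed.

Lemma normr_Im x : `|complex.Im x|%:C <= `|x|.
Proof.
by case: x => a b; rewrite normc_def lecR -sqrtr_sqr ler_wsqrtr // lerDr sqr_ge0.
Qed.

Lemma normr_complex_le (a b : R) : `|a +i* b| <= (`|a| + `|b|)%:C.
Proof.
rewrite normc_def lecR /= -(ler_pXn2r (n := 2)) ?nnegrE ?sqrtr_ge0 ?addr_ge0 //.
rewrite sqr_sqrtr ?addr_ge0 ?sqr_ge0 // sqrrD !real_normK ?num_real //.
by rewrite addrAC lerDl mulrn_wge0 // mulr_ge0.
Qed.

Lemma near_dist_lt x (e : R[i]) : 0 < e -> \forall y \near x, `|x - y| < e.
Proof.
by move=> e0; apply/(@nbhs_normP R[i]); exists e.
Qed.

Lemma continuous_complex_Re : continuous (@complex.Re R : R[i] -> R).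
Proof.
move=> x; apply/(@cvgrPdist_lt R R^o R[i] (nbhs x)) => e e0.
have /(near_dist_lt x) : 0 < e%:C by rewrite ltcR.
apply: filterS => y; rewrite -ltcR; apply: le_lt_trans.
by rewrite -(raddfB (@complex.Re R)) normr_Re.
Qed.

Lemma continuous_complex_Im : continuous (@complex.Im R : R[i] -> R).
Proof.
move=> x; apply/(@cvgrPdist_lt R R^o R[i] (nbhs x)) => e e0.
have /(near_dist_lt x) : 0 < e%:C by rewrite ltcR.
apply: filterS => y; rewrite -ltcR; apply: le_lt_trans.
by rewrite -(raddfB (@complex.Im R)) normr_Im.
Qed.

Lemma continuous_conj : continuous (Num.conj : R[i] -> R[i]).
Proof.
move=> x; apply/(@cvgrPdist_lt R[i] R[i] R[i] (nbhs x)) => e /(near_dist_lt x).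
by apply: filterS => y; rewrite -rmorphB /= norm_conjC.
Qed.

Lemma continuous_complex_horner (p : {poly R[i]}) : continuous (horner p : R[i] -> R[i]).
Proof.
elim/poly_ind: p => [|p c IH] x.
  by rewrite (_ : horner 0 = cst 0); [exact: cst_continuous | apply/funext => y; rewrite horner0].
rewrite (_ : horner _ = fun y => p.[y] * y + c); last first.
  by apply/funext => y; rewrite !hornerE.
apply: (@cvgD R[i] R[i] R[i] (nbhs x)); last exact: cst_continuous.
by apply: (@cvgM R[i] R[i] (nbhs x)); [exact: IH | exact: cvg_id].
Qed.

Lemma normr_normc x : `|x| = (Normc.normc x)%:C.
Proof. by []. Qed.

Lemma normr_real_complex (a : R) : `|a%:C| = `|a|%:C.
Proof. by rewrite normc_def /= expr0n /= addr0 sqrtr_sqr. Qed.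

Lemma continuous_normc : continuous (@Normc.normc R : R[i] -> R).
Proof.
move=> x; apply/(@cvgrPdist_lt R R^o R[i] (nbhs x)) => e e0.
have /(near_dist_lt x) : 0 < e%:C by rewrite ltcR.
apply: filterS => y; rewrite -ltcR; apply: le_lt_trans.
by rewrite -normr_real_complex raddfB; exact: (@ler_dist_dist R[i] R[i] x y).
Qed.

Lemma compact_complex_bounded A : compact A ->
  exists2 M : R, 0 < M & forall x, A x -> `|x| <= M%:C.
Proof.
move=> cA.
have /(@compact_bounded R R^o)[M [_ Mle]] :
    compact ((@Normc.normc R) @` A).
  apply: (@continuous_compact R[i] R) => //.
  exact/continuous_subspaceT/continuous_normc.
exists (`|M| + 1) => [|x Ax]; first by rewrite ltr_wpDl.
have /Mle/(_ (Normc.normc x)) : M < `|M| + 1 by rewrite ltr_pwDr // ler_norm.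
rewrite normr_normc lecR => le_x.
by apply: le_trans (le_x _); [exact: ler_norm | exists x].
Qed.

(** The square is the continuous image of a product of two real segments. *)
Lemma compact_square (M : R) :
  compact [set z : R[i] | `|complex.Re z| <= M /\ `|complex.Im z| <= M].
Proof.
have -> : [set z : R[i] | `|complex.Re z| <= M /\ `|complex.Im z| <= M] =
    (fun ab : R * R => ab.1 +i* ab.2) @` (`[- M, M] `*` `[- M, M]).
  apply/seteqP; split => [[a b] /= [aM bM]|_ [[a b] /= [aM bM] <-]].
    by exists (a, b) => //=; rewrite !in_itv /= -!ler_norml.
  by move: aM bM; rewrite !in_itv /= -!ler_norml.
apply: (@continuous_compact (R * R)%type R[i]); last first.
  by apply: compact_setX; exact: segment_compact.
apply: continuous_subspaceT => -[a b].
apply/(@cvgrPdist_lt R[i] R[i] (R * R)%type (nbhs (a, b))) => e e0.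
have [r Er] : exists r : R, e = r%:C by apply/complex_realP; exact: gtr0_real.
have r0 : 0 < r / 2 by move: e0; rewrite Er ltcR => ?; rewrite divr_gt0.
near=> x; rewrite Er.
have -> : (a, b).1 +i* (a, b).2 - (x.1 +i* x.2) = (a - x.1) +i* (b - x.2) by [].
apply: le_lt_trans (normr_complex_le _ _) _; rewrite ltcR (splitr r).
apply: ltrD.
- near: x; move: (r / 2) r0.
  by apply/(@cvgrPdist_lt R R^o (R * R)%type (nbhs (a, b)) _ fst a); exact: cvg_fst.
- near: x; move: (r / 2) r0.
  by apply/(@cvgrPdist_lt R R^o (R * R)%type (nbhs (a, b)) _ snd b); exact: cvg_snd.
Unshelve. all: by end_near. Qed.

(** Neighbourhoods of infinity contain complements of closed compact sets; the square of half-side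
    [M] contains the disc of radius [M]. *)
Lemma near_infinity (M : R) :
  \forall w \near (None : one_point_compactification R[i]),
    if w is Some z then M%:C < `|z| else true.
Proof.
pose S := [set z : R[i] | `|complex.Re z| <= M /\ `|complex.Im z| <= M].
exists S.
  split; first exact: compact_square.
  by apply: compact_closed; [exact: norm_hausdorff | exact: compact_square].
move=> _ [[z Sz <-]|-> //].
rewrite real_ltNge ?normr_real ?complex_real //; apply/negP => zM; apply: Sz.
by split; rewrite -lecR (le_trans _ zM) // ?normr_Re ?normr_Im.
Qed.

End ComplexTopology.

(** * Integration against a measure with compact support *)

Section SupportIntegration.
Context {R : realType} (mu : {finite_measure set R[i] -> \bar R}).
Hypothesis cS : compact (supp mu).
Local Notation S := (supp mu).
Implicit Types (f g : R[i] -> R) (h k : R[i] -> R[i]).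

Lemma open_measurable_complex (U : set R[i]) : open U -> measurable U.
Proof. by move=> oU; exact: sub_sigma_algebra. Qed.

Lemma closed_supp : closed S.
Proof. by apply: compact_closed => //; exact: norm_hausdorff. Qed.

Lemma measurable_supp : measurable S.
Proof.
rewrite -[S]setCK; apply: measurableC; apply: open_measurable_complex.
exact/closed_openC/closed_supp.
Qed.

Lemma rat_complex_dense (z : R[i]) (e : R) : 0 < e ->
  exists q : rat * rat, `|ratr q.1 +i* ratr q.2 - z| < e%:C.
Proof.
move=> e0.
have near_rat (a : R) : exists q : rat, `|ratr q - a| < e / 2.
  have /rat_in_itvoo[q] : a - e / 2 < a + e / 2 by rewrite ltrD2l gtrN ?divr_gt0.
  by rewrite in_itv /= -ltr_distl; exists q.
have [q qz] := near_rat (complex.Re z); have [r rz] := near_rat (complex.Im z).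
exists (q, r); case: z qz rz => a b /= qz rz.
apply: (@le_lt_trans _ _ (`|ratr q - a| + `|ratr r - b|)%:C).
  exact: normr_complex_le.
by rewrite ltcR (splitr e) ltrD.
Qed.

(* The complement of the support is covered by the null balls with rational
   centre and radius 1 / (n + 1). *)
Lemma measure_setC_supp : mu (~` S) = 0%E.
Proof.
pose b (q : rat * rat * nat) : set R[i] :=
  ball (ratr q.1.1 +i* ratr q.1.2 : R[i]) (q.2.+1%:R^-1 : R)%:C.
have mb q : measurable (b q).
  by apply: open_measurable_complex; apply: (@ball_open R[i] R[i]).
pose F n : set R[i] := if unpickle n is Some q then
  if mu (b q) == 0%E then b q else set0 else set0.
have FE q : F (pickle q) = if mu (b q) == 0%E then b q else set0.
  by rewrite /F pickleK.
have mF n : measurable (F n).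
  by rewrite /F; case: unpickle => [q|//]; case: ifP.
apply/eqP; rewrite -measure_le0.
have FU : ~` S `<=` \bigcup_n F n.
  move=> z /existsNP[U /not_implyP[oU /not_implyP[Uz]]] /negP.
  rewrite lt0e measure_ge0 andbT negbK => /eqP muU.
  have /(@nbhs_ballP R[i])[e /= e0 eU] : nbhs z U by exact: open_nbhs_nbhs.
  have [r Er] : exists r : R, e = r%:C by apply/complex_realP; exact: gtr0_real.
  have r0 : 0 < r by move: e0; rewrite Er ltcR.
  (* With a centre closer to [z] than the radius, and a radius below [r / 2], the ball contains [z]
     and stays within [r] of it, hence inside [U]. *)
  have [n nr] : exists n : nat, n.+1%:R^-1 < r / 2.
    have [n _ /(_ n (leqnn n))] := near_infty_natSinv_lt (PosNum (divr_gt0 r0 (ltr0Sn R 1))).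
    by exists n.
  have n0 : 0 < n.+1%:R^-1 :> R by rewrite invr_gt0.
  have [q qz] := rat_complex_dense z _ n0.
  exists (pickle (q, n)); first exact: I.
  rewrite FE.
  have bU : b (q, n) `<=` U.
    move=> w; rewrite /b -(@ball_normE R[i] R[i]) /= => qw; apply: eU.
    rewrite -(@ball_normE R[i] R[i]) /= Er -(subrKA (ratr q.1 +i* ratr q.2)).
    apply: le_lt_trans (ler_normD _ _) _; rewrite distrC.
    apply: lt_trans (ltrD qz qw) _; rewrite -raddfD ltcR /=.
    by rewrite (splitr r) ltrD.
  have -> : mu (b (q, n)) == 0%E.
    rewrite -measure_le0 -muU; apply: le_measure; rewrite ?inE //.
    exact: open_measurable_complex.
  by rewrite /b -(@ball_normE R[i] R[i]) /= .
have mS : measurable (~` S) by apply: measurableC; exact: measurable_supp.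
apply: le_trans (measure_sigma_subadditive mu mF mS FU) _.
rewrite eseries0 // => n _ _; rewrite /F.
by case: unpickle => [q|]; rewrite ?measure0 //; case: ifP => [/eqP //|]; rewrite measure0.
Qed.

Lemma continuous_measurable_complex f : continuous f -> measurable_fun setT f.
Proof.
move=> /continuousP cf; apply: (measurability _ (RGenOpens.measurableE R)).
move=> _ [_ [a [b ->] <-]]; rewrite setTI; apply: open_measurable_complex.
exact/cf/interval_open.
Qed.

(** [f] may be unbounded on the plane, but it is bounded on the compact support, whose complement is
    null. *)
Lemma continuous_integrable f : continuous f -> mu.-integrable setT (EFin \o f).
Proof.
move=> cf; have mf := continuous_measurable_complex _ cf.
apply/(negligible_integrable (measurableC measurable_supp)) => //.
- exact/measurable_EFinP.
- exact: measure_setC_supp.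
rewrite setTD setCK; apply: measurable_bounded_integrable.
- exact: measurable_supp.
- by rewrite -ge0_fin_numE // fin_num_measure //; exact: measurable_supp.
- exact: measurable_funTS.
have /(@compact_bounded R R^o)[M [_ mrt]] : compact (f @` S).
  by apply: (@continuous_compact R[i] R) => //; exact: continuous_subspaceT.
by exists M; split; rewrite ?num_real // => x Mx y Sy; apply: mrt => //; exists y.
Qed.

Lemma Rintegral_supp f : continuous f -> \int[mu]_x f x = \int[mu]_(x in S) f x.
Proof.
move=> cf; rewrite /Rintegral.
rewrite (negligible_integral (measurableC measurable_supp)) //.
- by rewrite setTD setCK.
- exact: continuous_integrable.
- exact: measure_setC_supp.
Qed.

Lemma le_Rintegral_supp f g : continuous f -> continuous g ->
  (forall x, S x -> f x <= g x) -> \int[mu]_x f x <= \int[mu]_x g x.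
Proof.
move=> cf cg fg; rewrite !Rintegral_supp //; apply: le_Rintegral => //.
- exact: measurable_supp.
- by apply: integrableS (continuous_integrable _ cf) => //; exact: measurable_supp.
- by apply: integrableS (continuous_integrable _ cg) => //; exact: measurable_supp.
Qed.

End SupportIntegration.

(** * The inner product of the measure on polynomials *)

Section PolynomialForm.
Context {R : realType} (mu : {finite_measure set R[i] -> \bar R}).
Hypothesis cS : compact (supp mu).
Local Notation S := (supp mu).
Implicit Types (h k : R[i] -> R[i]) (p q : {poly R[i]}).

Let continuous_Re h : continuous h -> continuous (fun z => complex.Re (h z)).
Proof.
move=> ch x; apply: (@continuous_comp R[i] R[i] R h (@complex.Re R)); first exact: ch.
exact: continuous_complex_Re.
Qed.

Let continuous_Im h : continuous h -> continuous (fun z => complex.Im (h z)).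
Proof.
move=> ch x; apply: (@continuous_comp R[i] R[i] R h (@complex.Im R)); first exact: ch.
exact: continuous_complex_Im.
Qed.

Lemma CintegralD h k : continuous h -> continuous k ->
  Cintegral mu (fun z => h z + k z) = Cintegral mu h + Cintegral mu k.
Proof.
move=> ch ck; rewrite /Cintegral; congr (_ +i* _).
  under eq_Rintegral do rewrite raddfD.
  by rewrite RintegralD //; apply: continuous_integrable => //; exact: continuous_Re.
under eq_Rintegral do rewrite raddfD.
by rewrite RintegralD //; apply: continuous_integrable => //; exact: continuous_Im.
Qed.

Lemma CintegralZ (a : R[i]) h : continuous h ->
  Cintegral mu (fun z => a * h z) = a * Cintegral mu h.
Proof.
move=> ch; case: a => a b; rewrite /Cintegral.
have iRe : mu.-integrable setT (EFin \o (fun z => complex.Re (h z))).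
  by apply: continuous_integrable => //; exact: continuous_Re.
have iIm : mu.-integrable setT (EFin \o (fun z => complex.Im (h z))).
  by apply: continuous_integrable => //; exact: continuous_Im.
have iZ c f : mu.-integrable setT (EFin \o f) ->
    mu.-integrable setT (EFin \o (fun z => c * f z)) by exact: integrableZl.
simpc; congr (_ +i* _).
  rewrite -!RintegralZl // -RintegralB //; try exact: iZ.
  by apply: eq_Rintegral => z _; case: (h z).
rewrite -!RintegralZl // -RintegralD //; try exact: iZ.
by apply: eq_Rintegral => z _; case: (h z).
Qed.

Lemma Cintegral_conj h : continuous h ->
  Cintegral mu (fun z => (h z)^*) = (Cintegral mu h)^*.
Proof.
move=> ch; rewrite /Cintegral; have -> (a b : R) : (a +i* b)^* = a +i* (- b) by [].
congr (_ +i* _); first by apply: eq_Rintegral => z _; case: (h z).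
rewrite -mulN1r -RintegralZl //; last first.
  by apply: continuous_integrable => //; exact: continuous_Im.
by apply: eq_Rintegral => z _; rewrite mulN1r; case: (h z).
Qed.

Lemma le_Re_Cintegral h k : continuous h -> continuous k ->
  (forall x, S x -> complex.Re (h x) <= complex.Re (k x)) ->
  complex.Re (Cintegral mu h) <= complex.Re (Cintegral mu k).
Proof. by move=> ch ck hk; apply: le_Rintegral_supp => //; exact: continuous_Re. Qed.

Lemma le_Cintegral h k : continuous h -> continuous k ->
  (forall x, S x -> h x <= k x) -> Cintegral mu h <= Cintegral mu k.
Proof.
move=> ch ck hk; rewrite lecE; apply/andP; split.
  (* The order of [R[i]] demands equal imaginary parts; the equality of their integrals is obtained
     as two inequalities. *)
  rewrite /= eq_le !le_Rintegral_supp //; try exact: continuous_Im.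
    by move=> x /hk; rewrite lecE => /andP[/eqP ->].
  by move=> x /hk; rewrite lecE => /andP[/eqP ->].
apply: le_Re_Cintegral => //.
by move=> x /hk; rewrite lecE => /andP[].
Qed.

Lemma continuous_conjM p q : continuous (fun z : R[i] => p.[z]^* * q.[z]).
Proof.
move=> x; apply: (@cvgM R[i] R[i] (nbhs x)); last exact: (continuous_complex_horner q x).
apply: (@continuous_comp R[i] R[i] R[i] (horner p) Num.conj).
  exact: (continuous_complex_horner p x).
exact: continuous_conj.
Qed.

Lemma continuousZc (a : R[i]) h : continuous h -> continuous (fun z => a * h z).
Proof.
move=> ch x; apply: (@cvgM R[i] R[i] (nbhs x)); first exact: cst_continuous.
exact: ch.
Qed.

Definition poly_inner p q : R[i] := inner mu (horner p) (horner q).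

Lemma poly_inner_psd : psd_form poly_inner.
Proof.
have cM := continuous_conjM.
split=> [a p q r|p q|p].
- rewrite /poly_inner /inner -CintegralZ // -CintegralD //; last exact: continuousZc.
  by congr Cintegral; apply/funext => z; rewrite hornerD hornerZ mulrDr mulrCA.
- rewrite /poly_inner /inner -Cintegral_conj //.
  by congr Cintegral; apply/funext => z; rewrite rmorphM /= conjCK mulrC.
- have -> : 0 = Cintegral mu (cst 0) by rewrite /Cintegral /= /Rintegral !integral0.
  apply: le_Cintegral => //; first exact: cst_continuous.
  by move=> x _; rewrite mulrC -normCK exprn_ge0.
Qed.

(** Multiplying the inner product by the unimodular number [- e] keeps its modulus and turns the
    integrand into [e * (z - x) * |q x|^2], whose real part is at least [d * |q x|^2] on the
    support. *)
Lemma poly_inner_lower (z e : R[i]) (d : R) : `|e| = 1 ->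
  (forall x, S x -> d <= complex.Re (e * (z - x))) ->
  forall q, d%:C * poly_inner q q <= `|poly_inner q (('X - z%:P) * q)|.
Proof.
move=> e1 dS q; have cM := continuous_conjM; set w := poly_inner _ (_ * q).
have <- : `|- e * w| = `|w| by rewrite normrM normrN e1 mul1r.
apply: le_trans (normr_Re _); apply: le_trans (_ : _ <= (complex.Re (- e * w))%:C) _.
  rewrite lecE; apply/andP; split.
    have := psd_ge0 _ poly_inner_psd q.
    by case: (poly_inner q q) => a b; rewrite lecE /= => /andP[/eqP ->]; rewrite mulr0 mul0r addr0.
  rewrite /w /poly_inner /inner -!CintegralZ //.
  apply: le_Re_Cintegral; [exact: continuousZc | exact: continuousZc |].
  move=> x /dS; rewrite hornerM hornerXsubC.
  have -> : - e * (q.[x]^* * ((x - z) * q.[x])) = (e * (z - x)) * (`|q.[x]| ^+ 2).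
    by rewrite normCK; ring.
  have -> : q.[x]^* * q.[x] = `|q.[x]| ^+ 2 by rewrite normCK mulrC.
  rewrite -add_Re2_Im2; case: (e * _) => a b /= ad.
  by rewrite !mulr0 !subr0 ler_wpM2r // addr_ge0 ?sqr_ge0.
by rewrite lecR ler_norm.
Qed.

Lemma poly_inner_upper (z : R[i]) (D : R) :
  (forall x, S x -> `|z - x| <= D%:C) ->
  forall q, poly_inner (('X - z%:P) * q) (('X - z%:P) * q) <= D%:C ^+ 2 * poly_inner q q.
Proof.
move=> DS q; have cM := continuous_conjM.
rewrite /poly_inner /inner -CintegralZ //; apply: le_Cintegral => //.
  exact: continuousZc.
move=> x /DS zxD; rewrite !hornerM !hornerXsubC mulrC -normCK normrM exprMn.
rewrite [_^* * _]mulrC -normCK ler_wpM2r ?exprn_ge0 // distrC.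
by rewrite lerXn2r // nnegrE ?(le_trans _ zxD).
Qed.

Lemma Re_conjM (x : R[i]) : complex.Re (x^* * x) = Normc.normc x ^+ 2.
Proof. by case: x => a b /=; rewrite sqr_sqrtr ?addr_ge0 ?sqr_ge0 //; ring. Qed.

(** This carries the hypothesis on the extended-real norm over to the algebraic form; integrability
    of [|q|^2] makes the integral a real number. *)
Lemma L2norm_horner q :
  L2norm mu (horner q) = (Num.sqrt (complex.Re (poly_inner q q)))%:E.
Proof.
rewrite /L2norm unlock.
have -> : complex.Re (poly_inner q q) = \int[mu]_z (Normc.normc q.[z]) ^+ 2.
  rewrite /poly_inner /inner /Cintegral /=; apply: eq_Rintegral => z _.
  exact: Re_conjM.
have int2 : mu.-integrable setT (EFin \o (fun z => (Normc.normc q.[z]) ^+ 2)).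
  apply: continuous_integrable => //.
  have -> : (fun z : R[i] => (Normc.normc q.[z]) ^+ 2) =
            (fun z => complex.Re (q.[z]^* * q.[z])).
    by apply/funext => z; rewrite Re_conjM.
  exact/continuous_Re/continuous_conjM.
have -> : (\int[mu]_z (`|(Normc.normc q.[z])%:E| `^ 2) =
    (\int[mu]_z (Normc.normc q.[z]) ^+ 2)%:E)%E.
  rewrite /Rintegral fineK; last exact: integrable_fin_num.
  apply: eq_integral => z _; rewrite abse_EFin poweR_EFin powR_mulrn //.
  by rewrite real_normK // num_real.
by rewrite poweR_EFin powR12_sqrt // Rintegral_ge0 // => z _; rewrite sqr_ge0.
Qed.

End PolynomialForm.

(** * Positive dependence of three unit vectors in the plane *)

Section PlaneSeparation.
Context {R : realType}.

(* Two unit vectors a, b at the largest angle among a family of directions,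
   m = a.b; x and y are the products of a third direction t with a and b. *)
Lemma gram_coefficient_le0 (m x y : R) :
  x ^+ 2 + y ^+ 2 - 2 * m * x * y = 1 - m ^+ 2 ->
  -1 < m -> m < 1 -> m <= x -> m <= y -> x <= 1 -> x + y <= 0 -> x - m * y <= 0.
Proof.
move=> + m1 m1' mx my x1 xy.
have m0 : m <= 0 by lra.
have p1 : 0 < 1 + m by lra.
have p2 : 0 < 1 - m by lra.
have [x0 _|x0 E] := leP x 0.
  have [y0|y0] := leP y 0.
    have : 0 <= m * y by apply: mulr_le0.
    by move: (m * y) => z z0; lra.
  have : 0 <= y * (1 + m) by apply: mulr_ge0; apply: ltW.
  by rewrite mulrDr mulr1 [y * m]mulrC; move: (m * y) => z z0; lra.
have y0 : y < 0 by clear E; lra.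
rewrite leNgt; apply/negP => h.
(* The first hypothesis says that the Gram determinant of three plane vectors vanishes, and it
   completes to this square. As [m <= y < 0], it yields [1 - m ^+ 2 <= x - m * y], while
   [x + y <= 0] yields [x - m * y <= x * (1 + m)]. Hence [1 - m <= x], against [x <= 1]. *)
have sq : (x - m * y) ^+ 2 = (1 - m ^+ 2) * (1 - y ^+ 2).
  have -> : (x - m * y) ^+ 2 = (x ^+ 2 + y ^+ 2 - 2 * m * x * y) + (m ^+ 2 - 1) * y ^+ 2.
    by ring.
  by rewrite E; ring.
have y2 : y ^+ 2 <= m ^+ 2.
  by clear E sq; rewrite -sqrrN -[leRHS]sqrrN lerXn2r // ?nnegrE; lra.
have m2E : 1 - m ^+ 2 = (1 - m) * (1 + m) by ring.
have m2 : 0 < 1 - m ^+ 2 by rewrite m2E mulr_gt0.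
have h1 : 1 - m ^+ 2 <= x - m * y.
  rewrite -(@ler_pXn2r _ 2) ?nnegrE ?(ltW m2) ?(ltW h) // sq expr2.
  by apply: ler_wpM2l; [exact: ltW | rewrite lerD2l lerN2].
have h2 : 0 <= - m * (- x - y) by clear E sq; apply: mulr_ge0; lra.
have h3 : (1 - m) * (1 + m) <= x * (1 + m).
  rewrite -m2E (le_trans h1) // -subr_ge0; apply: le_trans h2 _.
  by rewrite le_eqVlt; apply/orP; left; apply/eqP; ring.
by move: h3; clear E sq h1 h2; rewrite ler_pM2r //; lra.
Qed.

(** By Cramer's rule [(1 - m ^+ 2) t = (x - m * y) a + (y - m * x) b]. Both coefficients on the
    right are nonpositive by [gram_coefficient_le0], so moving them to the left gives the
    nonnegative weights. *)
Lemma circle_combination (a1 a2 b1 b2 t1 t2 : R) :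
  a1 ^+ 2 + a2 ^+ 2 = 1 -> b1 ^+ 2 + b2 ^+ 2 = 1 -> t1 ^+ 2 + t2 ^+ 2 = 1 ->
  a1 * b1 + a2 * b2 <= t1 * a1 + t2 * a2 ->
  a1 * b1 + a2 * b2 <= t1 * b1 + t2 * b2 ->
  t1 * (a1 + b1) + t2 * (a2 + b2) <= 0 ->
  exists p q r : R, [/\ [/\ 0 <= p, 0 <= q & 0 <= r], 0 < p + q + r,
    p * a1 + q * b1 + r * t1 = 0 & p * a2 + q * b2 + r * t2 = 0].
Proof.
move=> na nb nt; set m := a1 * b1 + a2 * b2.
set x := t1 * a1 + t2 * a2; set y := t1 * b1 + t2 * b2 => mx my.
have -> : t1 * (a1 + b1) + t2 * (a2 + b2) = x + y by rewrite /x /y; ring.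
move=> xy.
have sumE : (a1 + b1) ^+ 2 + (a2 + b2) ^+ 2 = 2 + 2 * m.
  transitivity ((a1 ^+ 2 + a2 ^+ 2) + (b1 ^+ 2 + b2 ^+ 2) + 2 * m); first by rewrite /m; ring.
  by rewrite na nb.
have subE : (a1 - b1) ^+ 2 + (a2 - b2) ^+ 2 = 2 - 2 * m.
  transitivity ((a1 ^+ 2 + a2 ^+ 2) + (b1 ^+ 2 + b2 ^+ 2) - 2 * m); first by rewrite /m; ring.
  by rewrite na nb.
have le1 c1 c2 : c1 ^+ 2 + c2 ^+ 2 = 1 -> t1 * c1 + t2 * c2 <= 1.
  move=> nc; have : 0 <= (t1 - c1) ^+ 2 + (t2 - c2) ^+ 2 by rewrite addr_ge0 ?sqr_ge0.
  have -> : (t1 - c1) ^+ 2 + (t2 - c2) ^+ 2 =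
      (t1 ^+ 2 + t2 ^+ 2) + (c1 ^+ 2 + c2 ^+ 2) - 2 * (t1 * c1 + t2 * c2) by ring.
  by rewrite nt nc; move: (t1 * c1 + _) => w; clear; lra.
have x1 : x <= 1 by exact: le1.
have y1 : y <= 1 by exact: le1.
have m_ge : -1 <= m.
  have : 0 <= (a1 + b1) ^+ 2 + (a2 + b2) ^+ 2 by rewrite addr_ge0 ?sqr_ge0.
  by rewrite sumE; clear; move: {+}m => w; lra.
have [mN1|mN1] := eqVneq m (-1).
  (* Here [a] and [b] are opposite, as [|a + b|^2 = 2 + 2 m = 0]. *)
  exists 1, 1, 0; split=> //; rewrite ?mul1r ?mul0r ?addr0 ?ltr0n //.
    move/eqP: sumE; rewrite mN1 mulrN1 subrr paddr_eq0 ?sqr_ge0 // !sqrf_eq0.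
    by case/andP => /eqP.
  move/eqP: sumE; rewrite mN1 mulrN1 subrr paddr_eq0 ?sqr_ge0 // !sqrf_eq0.
  by case/andP => _ /eqP.
have m_gt : -1 < m by rewrite lt_def mN1.
have m_lt : m < 1 by move: mx my xy; clear; move: {+}m {+}x {+}y => *; lra.
have relE : x ^+ 2 + y ^+ 2 - 2 * m * x * y = 1 - m ^+ 2.
  (* The vanishing Gram determinant, written so that the last two terms disappear for unit
     vectors. *)
  transitivity ((t1 ^+ 2 + t2 ^+ 2) * ((a1 ^+ 2 + a2 ^+ 2) * (b1 ^+ 2 + b2 ^+ 2) - m ^+ 2)
    + (1 - (a1 ^+ 2 + a2 ^+ 2)) * y ^+ 2 + (1 - (b1 ^+ 2 + b2 ^+ 2)) * x ^+ 2).
    by rewrite /m /x /y; ring.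
  by rewrite na nb nt; ring.
have relE' : y ^+ 2 + x ^+ 2 - 2 * m * y * x = 1 - m ^+ 2 by rewrite -relE; ring.
have p0 : x - m * y <= 0 by exact: gram_coefficient_le0.
have q0 : y - m * x <= 0 by apply: gram_coefficient_le0 => //; rewrite addrC.
have r0 : 0 < 1 - m ^+ 2.
  by rewrite -[1](expr1n _ 2%N) subr_sqr mulr_gt0 ?subr_gt0 // -ltrBlDl sub0r.
exists (- (x - m * y)), (- (y - m * x)), (1 - m ^+ 2); split.
- by rewrite !oppr_ge0 p0 q0 (ltW r0).
- by rewrite ltr_wpDl // addr_ge0 // oppr_ge0.
- transitivity ((1 - (a1 ^+ 2 + a2 ^+ 2) * (b1 ^+ 2 + b2 ^+ 2)) * t1
    + ((b1 ^+ 2 + b2 ^+ 2) - 1) * x * a1 + ((a1 ^+ 2 + a2 ^+ 2) - 1) * y * b1).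
    by rewrite /m /x /y; ring.
  by rewrite na nb; ring.
- transitivity ((1 - (a1 ^+ 2 + a2 ^+ 2) * (b1 ^+ 2 + b2 ^+ 2)) * t2
    + ((b1 ^+ 2 + b2 ^+ 2) - 1) * x * a2 + ((a1 ^+ 2 + a2 ^+ 2) - 1) * y * b2).
    by rewrite /m /x /y; ring.
  by rewrite na nb; ring.
Qed.

End PlaneSeparation.

(** * Strict separation of a point from the hull of a compact set *)

Section HullSeparation.
Context {R : realType}.
Implicit Types (A B : set R[i]) (x y z w : R[i]).

Lemma normc_gt0 x : (0 < Normc.normc x) = (x != 0).
Proof. by rewrite -normr_gt0 -ltcR. Qed.

Lemma complex_ReB x y : complex.Re (x - y) = complex.Re x - complex.Re y.
Proof. by case: x => a b; case: y. Qed.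

Lemma normc_ge0 x : 0 <= Normc.normc x.
Proof. by case: x => a b; exact: sqrtr_ge0. Qed.

Lemma convex_combination2 B x y (p q : R) : @convex_set R (Rcomplex R) B ->
  B x -> B y -> 0 <= p -> 0 <= q -> p + q = 1 -> B (p%:C * x + q%:C * y).
Proof.
move=> cB Bx By p0 q0 pq.
have p01 : 0 <= p <= 1 by rewrite p0 -pq lerDl.
have := cB x y (Itv01 p0 (andP p01).2); rewrite !inE => /(_ Bx By).
congr B; rewrite /conv /=.
have -> : q = 1 - p by rewrite -pq addrC addKr.
by case: x {Bx} => x1 x2; case: y {By} => y1 y2; simpc.
Qed.

Lemma convex_hull_combination3 A x y w z (p q r : R) :
  A x -> A y -> A w -> 0 <= p -> 0 <= q -> 0 <= r -> 0 < p + q + r ->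
  p%:C * (x - z) + q%:C * (y - z) + r%:C * (w - z) = 0 -> convex_hull A z.
Proof.
move=> Ax Ay Aw p0 q0 r0 s0 E B [cB AB].
set s := p + q + r in s0.
have zE : z = (p / s)%:C * x + (q / s)%:C * y + (r / s)%:C * w.
  have sC : s%:C != 0 :> R[i] by rewrite gt_eqF // ltcR.
  rewrite !rmorphM /= !fmorphV; apply: (mulfI sC).
  have -> : s%:C * z = p%:C * x + q%:C * y + r%:C * w.
    apply/eqP; rewrite eq_sym -subr_eq0 -E /s !rmorphD /=; apply/eqP; ring.
  by field.
have ps : p / s + q / s + r / s = 1 by rewrite -!mulrDl divff ?gt_eqF.
(* Convexity is binary: the points [y] and [w] are combined first with renormalised weights, which
   requires that these weights do not both vanish. *)
have [s2|s2] := eqVneq (q / s + r / s) 0.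
  have q0' : q / s = 0.
    by apply/eqP; move/eqP: s2; rewrite paddr_eq0 ?divr_ge0 ?(ltW s0) // => /andP[].
  have r0' : r / s = 0 by move: s2; rewrite q0' add0r.
  have p1 : p / s = 1 by move: ps; rewrite q0' r0' !addr0.
  by rewrite zE q0' r0' p1 !mul0r !addr0 mul1r; exact: AB.
have s2_gt0 : 0 < q / s + r / s.
  by rewrite lt_def s2 addr_ge0 ?divr_ge0 ?(ltW s0).
have -> : z = (p / s)%:C * x + (q / s + r / s)%:C *
    ((q / s / (q / s + r / s))%:C * y + (r / s / (q / s + r / s))%:C * w).
  rewrite zE mulrDr !mulrA -!rmorphM /= ![_ * (_ / (q / s + r / s))]mulrC !divfK //.
  by rewrite addrA.
apply: convex_combination2 => //; first exact: AB.
- apply: convex_combination2 => //; [exact: AB|exact: AB| | |].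
  + by rewrite !divr_ge0 ?(ltW s0) ?(ltW s2_gt0).
  + by rewrite !divr_ge0 ?(ltW s0) ?(ltW s2_gt0).
  + by rewrite -mulrDl divff.
- by rewrite divr_ge0 ?(ltW s0).
- exact: ltW.
- by rewrite addrA.
Qed.

Lemma sub_convex_hull A : A `<=` convex_hull A.
Proof. by move=> x Ax B [_]; exact. Qed.

(** Project [A] radially from [z] to the unit circle and take, by compactness, two directions [a]
    and [b] at the widest angle. Every direction has positive product with [a + b]; otherwise
    [circle_combination] would place [z] in the hull. Compactness of [A] makes this positivity
    uniform. *)
Lemma convex_hull_separation A z : compact A -> A !=set0 -> ~ convex_hull A z ->
  exists (e : R[i]) (d : R), [/\ `|e| = 1, 0 < d &
    forall x, A x -> d <= complex.Re (e * (z - x))].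
Proof.
move=> cA [x0 Ax0] zA.
have neqz x : A x -> x - z != 0.
  by move=> Ax; rewrite subr_eq0; apply/eqP => xz; apply: zA; rewrite -xz; exact: sub_convex_hull.
pose u x := (x - z) / `|x - z|.
pose T := u @` A.
have uT x : A x -> `|u x| = 1.
  by move=> /neqz xz; rewrite normrM normfV normr_id divff ?normr_eq0.
have cT : compact T.
  apply: (@continuous_compact R[i] R[i]) => //; apply: continuous_in_subspaceT => x.
  rewrite inE => /neqz xz.
  have csub : {for x, continuous (fun y : R[i] => y - z)}.
    by apply: (@cvgD R[i] R[i] R[i] (nbhs x)); [exact: cvg_id | exact: cst_continuous].
  apply: (@cvgM R[i] R[i] (nbhs x)); first exact: csub.
  apply: (@cvgV R[i] R[i] (nbhs x)); first by rewrite normr_eq0.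
  exact: (@cvg_norm R[i] R[i] R[i] (nbhs x) _ _ _ csub).
pose dot (a b : R[i]) : R := complex.Re (a * b^*).
have [[a b]] : exists2 ab : R[i] * R[i], ab \in T `*` T &
    forall t, t \in T `*` T -> dot ab.1 ab.2 <= dot t.1 t.2.
  apply: compact_EVT_min; first by exists (u x0, u x0); split; exists x0.
    exact: compact_setX.
  apply: continuous_subspaceT => t.
  apply: (@continuous_comp _ R[i] R (fun t : R[i] * R[i] => t.1 * t.2^*)); last first.
    exact: continuous_complex_Re.
  apply: (@cvgM R[i] _ (nbhs t)); first exact: cvg_fst.
  apply: (@continuous_comp _ R[i] R[i] snd Num.conj); first exact: cvg_snd.
  exact: continuous_conj.
rewrite inE => -[/= [xa Axa ua] [xb Axb ub]] min_ab.
have dotE c d : dot c d =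
    complex.Re c * complex.Re d + complex.Im c * complex.Im d.
  by case: c => c1 c2; case: d => d1 d2; rewrite /dot /= mulrN opprK.
have normE (c : R[i]) : `|c| = 1 -> complex.Re c ^+ 2 + complex.Im c ^+ 2 = 1.
  by move=> c1; have := congr1 (@complex.Re R) (add_Re2_Im2 c); rewrite c1 expr1n.
have n_gt0 x : A x -> 0 < Normc.normc (x - z).
  by move=> /neqz; rewrite normc_gt0.
have uE x : u x = ((Normc.normc (x - z))^-1)%:C * (x - z).
  by rewrite fmorphV /= /u normr_normc mulrC.
have pos x : A x -> 0 < dot (x - z) (a + b).
  move=> Ax; rewrite ltNge; apply/negP => dot_le0; apply: zA.
  have na : `|a| = 1 by rewrite -ua uT.
  have nb : `|b| = 1 by rewrite -ub uT.
  have Tt : T (u x) by exists x.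
  have Ta : T a by exists xa.
  have Tb : T b by exists xb.
  have le_a : dot a b <= dot (u x) a by apply: (min_ab (u x, a)); rewrite inE.
  have le_b : dot a b <= dot (u x) b by apply: (min_ab (u x, b)); rewrite inE.
  have le_ab : dot (u x) (a + b) <= 0.
    have -> : dot (u x) (a + b) = (Normc.normc (x - z))^-1 * dot (x - z) (a + b).
      rewrite uE !dotE; case: (x - z) => c1 c2; case: (a + b) => d1 d2 /=.
      by ring.
    by rewrite mulr_ge0_le0 // invr_ge0 ltW ?n_gt0.
  move: le_a le_b le_ab; rewrite !dotE !raddfD /= => le_a le_b le_ab.
  have [p [q [r [[p0 q0 r0] pqr E1 E2]]]] :=
    circle_combination _ _ _ _ _ _ (normE _ na) (normE _ nb) (normE _ (uT _ Ax)) le_a le_b le_ab.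
  (* Dividing the weights by the distances to [z] turns the relation between unit directions into
     one between the differences with [z]. *)
  pose n := fun x => (Normc.normc (x - z))^-1.
  have n0 y : A y -> 0 < n y by move=> /n_gt0; rewrite invr_gt0.
  apply: (@convex_hull_combination3 A xa xb x z (p * n xa) (q * n xb) (r * n x)) => //.
  - by rewrite mulr_ge0 // ltW ?n0.
  - by rewrite mulr_ge0 // ltW ?n0.
  - by rewrite mulr_ge0 // ltW ?n0.
  - have pn0 s y : A y -> 0 <= s -> 0 <= s * n y.
      by move=> /n0/ltW ? ?; exact: mulr_ge0.
    rewrite lt_def !addr_ge0 ?pn0 // andbT; apply: contraTneq pqr => /eqP.
    rewrite !paddr_eq0 ?addr_ge0 ?pn0 // !mulf_eq0.
    rewrite !(negPf (lt0r_neq0 (n0 _ _))) // !orbF.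
    by move=> /andP[/andP[/eqP -> /eqP ->] /eqP ->]; rewrite !addr0 ltxx.
  - rewrite !rmorphM /= -!mulrA -!uE ua ub.
    move: E1 E2; case: (a) => a1 a2; case: (b) => b1 b2; case: (u x) => t1 t2 /= E1 E2.
    by simpc; rewrite E1 E2.
have [x1] : exists2 c, c \in A &
    forall t, t \in A -> dot (c - z) (a + b) <= dot (t - z) (a + b).
  apply: compact_EVT_min => //; first by exists x0.
  apply: continuous_subspaceT => x.
  apply: (@continuous_comp R[i] R[i] R (fun y => (y - z) * (a + b)^*)); last first.
    exact: continuous_complex_Re.
  apply: (@cvgM R[i] R[i] (nbhs x)); last exact: cst_continuous.
  by apply: (@cvgD R[i] R[i] R[i] (nbhs x)); [exact: cvg_id | exact: cst_continuous].
rewrite inE => Ax1 min1.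
have ab0 : a + b != 0.
  apply: contraTneq (pos _ Ax0) => ->.
  by rewrite /dot rmorph0 mulr0 ltxx.
have nab : 0 < Normc.normc (a + b) by rewrite normc_gt0.
(* The unit vector along [a + b], conjugated because [dot] conjugates its second argument, and
   negated because the claim is about [z - x]; the gap is the minimum attained at [x1], rescaled. *)
exists (- (a + b)^* / `|a + b|), (dot (x1 - z) (a + b) / Normc.normc (a + b)); split.
- by rewrite normrM normrN norm_conjC normfV normr_id divff ?normr_eq0.
- by rewrite divr_gt0 ?pos.
- move=> x Ax.
  have -> : - (a + b)^* / `|a + b| * (z - x) =
      ((Normc.normc (a + b))^-1)%:C * ((x - z) * (a + b)^*).
    by rewrite fmorphV /= normr_normc; ring.
  have -> c (s : R) : complex.Re (s%:C * c) = s * complex.Re c.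
    by case: c => c1 c2 /=; rewrite mul0r subr0.
  by rewrite mulrC ler_wpM2l ?invr_ge0 ?(ltW nab) // min1 // inE.
Qed.

End HullSeparation.

(** * Quantitative bounds for the quotient off the hull *)

Section Asymptotics.
Context {R : realType} (mu : {finite_measure set R[i] -> \bar R}).
Variables (p Q : nat -> {poly R[i]}).
Hypotheses (cS : compact (supp mu)) (S0 : supp mu !=set0).
Hypothesis op : orthonormal_polys mu p.
Hypothesis sQ : forall n, size (Q n) = n.+1.
Local Notation S := (supp mu).
Local Notation B := (poly_inner mu).

Definition lead_ratio n : R[i] := lead_coef (Q n) / lead_coef (p n).
Definition remainder n : {poly R[i]} := Q n - lead_ratio n *: p n.
Definition remainder_norm n : R := Num.sqrt (complex.Re (B (remainder n) (remainder n))).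

(* [z] is separated from the support at a distance comparable, up to the
   factor [c], to the largest distance from [z] to the support. *)
Definition well_separated (c : R) (z : R[i]) := exists (e : R[i]) (d : R),
  [/\ `|e| = 1, 0 < d, forall x, S x -> d <= complex.Re (e * (z - x))
    & forall x, S x -> `|z - x| <= (c * d)%:C].


Let size_p n : size (p n) = n.+1. Proof. by case: op. Qed.

Let p_norm n : B (p n) (p n) = 1.
Proof. by case: op => _ _ /(_ n n); rewrite eqxx. Qed.

Let p_orth n (g : {poly R[i]}) : (size g <= n)%N -> B (p n) g = 0.
Proof.
move=> sg; apply: (@psd_orthogonal _ _ (poly_inner_psd _ cS) p _ n) => // i ni.
by case: op => _ _ /(_ n i); rewrite gtn_eqF.
Qed.

Let size_r n : (size (remainder n) <= n)%N.
Proof.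
have := @size_sub_lead_coef _ n (p n) (Q n) (size_p n).
by rewrite sQ leqnn => /(_ isT); rewrite /remainder /lead_ratio [lead_coef (Q n)]lead_coefE sQ.
Qed.

Let norm_r n : B (remainder n) (remainder n) = B (Q n) (Q n) - `|lead_ratio n| ^+ 2.
Proof. by apply: (psd_remainder _ (poly_inner_psd _ cS)) => //; exact/p_orth/size_r. Qed.


(** The right-hand side depends on [z] only through [c], which is what makes the convergence locally
    uniform. *)
Lemma norm_quotient_le c z n : 0 <= c -> well_separated c z ->
  `|(Q n).[z] / (p n).[z] - 1| <= (Normc.normc (lead_ratio n - 1) + c * remainder_norm n)%:C.
Proof.
move=> c0 [e [d [e1 d0 lo up]]].
have lower := poly_inner_lower _ cS _ _ _ e1 lo.
have upper := poly_inner_upper _ cS _ _ up.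
have dC : 0 < d%:C :> R[i] by rewrite ltcR.
have cdC : 0 <= (c * d)%:C :> R[i] by rewrite lecR mulr_ge0 // ltW.
have psdB := poly_inner_psd _ cS.
have pz0 : (p n).[z] != 0.
  exact: (orthonormal_neq0 _ psdB _ _ _ _ _ (p_norm n) (@p_orth n) (size_p n) dC cdC lower upper).
have := norm_horner_le_orthonormal _ psdB _ _ _ _ _ (p_norm n) (@p_orth n) (size_p n)
  dC cdC lower upper _ (size_r n).
set N := B (remainder n) (remainder n).
have N0 : 0 <= N by exact: psd_ge0.
have NE : N = (remainder_norm n ^+ 2)%:C.
  rewrite /remainder_norm -/N sqr_sqrtr; last by move: N0; rewrite lecE => /andP[].
  by rewrite RRe_real // ger0_real.
rewrite NE !normr_normc -!rmorphXn -!rmorphM lecR /= => le2.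
have np : 0 < Normc.normc (p n).[z] by rewrite normc_gt0.
have rn0 : 0 <= remainder_norm n by exact: sqrtr_ge0.
have le1 : Normc.normc (remainder n).[z] <= c * remainder_norm n * Normc.normc (p n).[z].
  have ge0 : 0 <= c * remainder_norm n * Normc.normc (p n).[z] by rewrite !mulr_ge0 // ltW.
  (* The extremal estimate was applied with [c * d] for [D], so [d ^+ 2] cancels. *)
  rewrite -(@ler_pXn2r _ 2) ?nnegrE ?normc_ge0 //.
  rewrite -(@ler_pM2l _ (d ^+ 2)) ?exprn_gt0 // (le_trans le2) //.
  by rewrite le_eqVlt; apply/orP; left; apply/eqP; ring.
have -> : (Q n).[z] / (p n).[z] - 1 = (lead_ratio n - 1) + (remainder n).[z] / (p n).[z].
  by rewrite /remainder hornerD hornerN hornerZ; field.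
apply: (@le_trans _ _ (`|lead_ratio n - 1| + `|(remainder n).[z] / (p n).[z]|)).
  exact: (@ler_normD R[i] R[i]).
have -> : `|(remainder n).[z] / (p n).[z]| = `|(remainder n).[z]| / `|(p n).[z]|.
  by rewrite normrM normfV.
rewrite !normr_normc.
rewrite -fmorphV -rmorphM -rmorphD lecR /= lerD2l.
by rewrite ler_pdivrMr.
Qed.

Hypothesis norm_to1 : L2norm mu (horner (Q n)) @[n --> \oo] --> 1%E.
Hypothesis lead_to1 : lead_ratio n @[n --> \oo] --> (1 : R[i]).

Lemma normc_lead_to0 : Normc.normc (lead_ratio n - 1) @[n --> \oo] --> (0 : R).
Proof.
have -> : (0 : R) = Normc.normc (1 - 1 : R[i]) by rewrite subrr Normc.normc0.
apply: (@continuous_cvg nat R[i] R \oo _ (fun n => lead_ratio n - 1) (@Normc.normc R) (1 - 1)).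
  exact: continuous_normc.
apply: (@cvgB R[i] R[i] nat \oo _ lead_ratio (cst 1) 1 1); [exact: lead_to1 | exact: cvg_cst].
Qed.

Lemma remainder_norm_to0 : remainder_norm n @[n --> \oo] --> (0 : R).
Proof.
have sqrt_to1 : Num.sqrt (complex.Re (B (Q n) (Q n))) @[n --> \oo] --> (1 : R).
  have /fine_cvgP[_] : (Num.sqrt (complex.Re (B (Q n) (Q n))))%:E @[n --> \oo] --> 1%:E.
    have -> : (fun n => (Num.sqrt (complex.Re (B (Q n) (Q n))))%:E) =
      (fun n => L2norm mu (horner (Q n))) by apply/funext => n; rewrite L2norm_horner.
    exact: norm_to1.
  exact.
have norm_to1' : Normc.normc (lead_ratio n) @[n --> \oo] --> (1 : R).
  have -> : (1 : R) = Normc.normc (1 : R[i]) by rewrite Normc.normc1.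
  apply: (@continuous_cvg nat R[i] R \oo _ lead_ratio (@Normc.normc R) 1) => //.
  exact: continuous_normc.
(* The squared norm of [Q n] is written as the square of its root, since the hypothesis gives the
   limit of the norm itself. *)
have -> : remainder_norm = (fun n => Num.sqrt (Num.sqrt (complex.Re (B (Q n) (Q n))) ^+ 2 -
    Normc.normc (lead_ratio n) ^+ 2)).
  apply/funext => n; rewrite /remainder_norm norm_r; congr Num.sqrt.
  have : 0 <= B (Q n) (Q n) by exact: psd_ge0 _ (poly_inner_psd _ cS) _.
  rewrite lecE => /andP[_ N0]; rewrite sqr_sqrtr //.
  by rewrite complex_ReB normCK [lead_ratio n * _]mulrC Re_conjM.
have -> : (0 : R) = Num.sqrt (1 ^+ 2 - 1 ^+ 2) by rewrite subrr sqrtr0.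
apply: (@continuous_cvg nat R R \oo); first exact: sqrt_continuous.
by apply: cvgB; apply: cvgM.
Qed.

Lemma near_quotient_bound (c eps : R) : 0 < eps ->
  \forall n \near \oo, Normc.normc (lead_ratio n - 1) + c * remainder_norm n < eps.
Proof.
move=> eps0.
have : (Normc.normc (lead_ratio n - 1) + c * remainder_norm n) @[n --> \oo] --> (0 + c * 0 : R).
  apply: cvgD; first exact: normc_lead_to0.
  by apply: cvgM; [exact: cvg_cst | exact: remainder_norm_to0].
rewrite mulr0 addr0 => /cvgrPdist_lt/(_ _ eps0); apply: filterS => n.
by rewrite sub0r normrN; apply: le_lt_trans; exact: ler_norm.
Qed.

(** The direction [e] found for [z0] serves every [z] within [d / 2] of it, with half the gap; [D]
    bounds the distances from such [z] to the support. *)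
Lemma separated_near z0 : ~ ch mu z0 ->
  exists2 c, 0 <= c & \forall z \near z0, well_separated c z.
Proof.
move=> /(convex_hull_separation _ _ cS S0)[e [d [e1 d0 lo]]].
have [M M0 Mx] := compact_complex_bounded _ cS.
pose D := Normc.normc z0 + M + d / 2.
have d2 : 0 < d / 2 by rewrite divr_gt0.
exists (D / (d / 2)).
  by rewrite divr_ge0 ?(ltW d2) // !addr_ge0 ?normc_ge0 ?(ltW M0) ?(ltW d2).
have /(near_dist_lt z0) : 0 < (d / 2)%:C :> R[i] by rewrite ltcR.
apply: filterS => z zz0; exists e, (d / 2); split=> // x Sx.
  have -> : e * (z - x) = e * (z0 - x) - e * (z0 - z) by ring.
  have : complex.Re (e * (z0 - z)) <= d / 2.
    rewrite -lecR (le_trans _ (ltW zz0)) // -[leRHS]mul1r -e1 -normrM.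
    by apply: le_trans (normr_Re _); rewrite lecR ler_norm.
  have := lo _ Sx; rewrite complex_ReB.
  move: (complex.Re _) (complex.Re _) => s t ds td.
  by rewrite {1}(splitr d); move: ds td; lra.
rewrite divfK ?gt_eqF //.
have -> : z - x = z0 - x - (z0 - z) by ring.
apply: le_trans (@ler_normB R[i] R[i] _ _) _; rewrite /D raddfD /=.
apply: lerD; last exact: ltW.
apply: le_trans (@ler_normB R[i] R[i] _ _) _; rewrite raddfD /=.
by rewrite lerD // Mx.
Qed.

(** With the support in the disc of radius [M], the direction of [z] gives the gap [|z| - M], while
    distances are at most [|z| + M]. For [|z| > 2 M] the latter is below [3 (|z| - M)], whence the
    constant 3. *)
Lemma separated_near_infinity :
  exists2 c, 0 <= c & \forall w \near (None : one_point_compactification R[i]),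
    if w is Some z then well_separated c z else True.
Proof.
have [M M0 Mx] := compact_complex_bounded _ cS.
exists 3 => //; apply: filterS (near_infinity (2 * M)) => -[z|//].
rewrite normr_normc ltcR => zM.
have z0 : z != 0 by rewrite -normc_gt0 (le_lt_trans _ zM) // mulr_ge0 // ltW.
exists (z^* / `|z|), (Normc.normc z - M); split.
- by rewrite normrM norm_conjC normfV normr_id divff ?normr_eq0.
- by rewrite subr_gt0 (le_lt_trans _ zM) // ler_peMl ?(ltW M0) // ler1n.
- move=> x /Mx xM.
  have -> : z^* / `|z| * (z - x) = `|z| - z^* / `|z| * x.
    rewrite mulrBr; congr (_ - _).
    by rewrite mulrAC [z^* * z]mulrC -normCK expr2 mulfK ?normr_eq0.
  rewrite complex_ReB lerD2l lerN2 -lecR; apply: le_trans xM.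
  apply: le_trans (_ : _ <= `|z^* / `|z| * x|) _.
    by apply: le_trans (normr_Re _); rewrite lecR ler_norm.
  by rewrite !normrM norm_conjC normfV normr_id divff ?normr_eq0 // mul1r.
- move=> x /Mx xM; apply: le_trans (@ler_normB R[i] R[i] _ _) _.
  apply: (@le_trans _ _ (Normc.normc z + M)%:C).
    by rewrite raddfD /= lerD.
  by rewrite lecR; lra.
Qed.

End Asymptotics.

(** * From local bounds to uniform convergence on compact sets *)

Local Open Scope complex_scope.

Theorem theorem2p2 (R : realType) (mu : {finite_measure set R[i] -> \bar R})
    (p Q : nat -> {poly R[i]}) :
  compact (supp mu) -> infinite_set (supp mu) ->
  orthonormal_polys mu p ->
  (forall n, size (Q n) = n.+1) ->
  L2norm mu (horner (Q n)) @[n --> \oo] --> 1%E ->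
  lead_coef (Q n) / lead_coef (p n) @[n --> \oo] --> (1 : R[i]) ->
  (forall z : R[i], ~ ch mu z ->
     (Q n).[z] / (p n).[z] @[n --> \oo] --> (1 : R[i])) /\
  (forall K : set (one_point_compactification R[i]), compact K ->
     K `<=` ~` (Some @` ch mu) ->
     {uniform K, (fun n => sphere_quotient (Q n) (p n)) @ \oo --> cst (1 : R[i])}).
Proof.
move=> cS infS op sQ norm_to1 lead_to1.
have S0 : supp mu !=set0.
  by apply/set0P/eqP => S0; apply: infS; rewrite S0; exact: finite_set0.
(* A joint neighbourhood in the point and the index is the local form that [compact_near_coveringP]
   makes uniform over [K]. *)
have near_local (w : one_point_compactification R[i]) (eps : R) : 0 < eps ->
    ~ (Some @` ch mu) w ->
    \forall w' \near w & n \near \oo, `|sphere_quotient (Q n) (p n) w' - 1| < eps%:C.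
  move=> eps0 chw.
  have [c c0 cw] : exists2 c, 0 <= c & \forall w' \near w,
      if w' is Some z then well_separated mu c z else True.
    case: w chw => [z|] chw; last exact: separated_near_infinity.
    have [|c c0 cz] := separated_near _ cS S0 z.
      by move=> chz; apply: chw; exists z.
    by exists c.
  have near_n := near_quotient_bound _ _ _ cS op sQ norm_to1 lead_to1 c _ eps0.
  exists ([set w' | if w' is Some z then well_separated mu c z else True],
    [set n | Normc.normc (lead_ratio p Q n - 1) + c * remainder_norm mu p Q n < eps]).
    by split; [exact: cw | exact: near_n].
  move=> [[z|] n] /= [sep lt_eps].
    by apply: le_lt_trans (norm_quotient_le _ _ _ cS op sQ _ _ n c0 sep) _; rewrite ltcR.
  (* At infinity the quotient is the ratio of leading coefficients, so the first term of the bound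
     suffices. *)
  rewrite normr_normc ltcR; apply: le_lt_trans lt_eps.
  by rewrite lerDl mulr_ge0 // sqrtr_ge0.
have posC (e : R[i]) : 0 < e -> exists2 r : R, 0 < r & e = r%:C.
  move=> e0; have /complex_realP[r Er] := gtr0_real e0.
  by exists r => //; rewrite -ltcR -Er.
split=> [z chz|K cK Kch].
  apply/(@cvgrPdist_lt R[i] R[i] nat \oo) => _ /posC[r r0 ->].
  have [|[U V] /= [Uz Vn] UV] := near_local (Some z) r r0.
    by move=> [y chy [yz]]; apply: chz; rewrite -yz.
  apply: filterS Vn => n Vn; rewrite distrC.
  by apply: (UV (Some z, n)); split => //; exact: nbhs_singleton Uz.
move=> P /uniform_nbhs[E [entE EP]].
move: entE; rewrite -(@entourage_ballE R[i] R[i]) => -[_ /posC[r r0 ->] ballE].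
have /compact_near_coveringP/(_ nat \oo
  (fun n w => `|sphere_quotient (Q n) (p n) w - 1| < r%:C)) := cK.
move=> /(_ _ (fun w Kw => near_local w r r0 (Kch w Kw))).
apply: filterS => n lt_r; apply: EP => w Kw; apply: ballE.
by rewrite -(@ball_normE R[i] R[i]) /= distrC; exact: lt_r.
Qed.
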